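(* Let $q\ge 2$ be an integer and let $p_0,\dots,p_{q-1}$ be non-negative real numbers with $\sum_{j=0}^{q-1}p_j=1$ and $p_j\neq 1$ for every $j$. Let $x_1,x_2,\dots$ be independent, identically distributed random variables with values in $\{0,\dots,q-1\}$ and $\mathbb{P}[x_i=j]=p_j$ for all $i\ge 1$ and $j\in\{0,\dots,q-1\}$. Put $X=\sum_{i=1}^\infty x_i q^{-i}$ and let $F(x)=\mathbb{P}[X\le x]$ be the cumulative distribution function of $X$. Then: (i) if $p_j=\frac1q$ for all $j$, then $F(x)=x$ on $[0,1]$; (ii) if $p_k\neq\frac1q$ for some $k$, then $F$ is singular. In either case, $F$ satisfies the following recursion formula: for every $k\in\{0,\dots,q-1\}$ and every $x$ with $\frac{k}{q}\le x\le\frac{k+1}{q}$, $$F(x)=\sum_{j=0}^{k-1}p_j+p_k\,F(qx-k),$$ where the empty sum (for $k=0$) is $0$.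
   Context: The random variable $x_i$ models the outcome of the $i$-th toss of a (possibly unfair) $q$-sided die with faces labelled $0,\dots,q-1$. A distribution function $F$ on $[0,1]$ is called singular if the associated probability measure is concentrated on a set of Lebesgue measure zero; equivalently, $F'(x)=0$ for Lebesgue-almost every $x\in[0,1]$. *)

(* Defs.v *)
From HB Require Import structures.
From mathcomp Require Import all_boot all_order all_algebra finmap.
From mathcomp Require Import all_classical all_reals all_analysis.
From mathcomp Require Import measurable_realfun.

Set Implicit Arguments.
Unset Strict Implicit.
Unset Printing Implicit Defensive.

Import Order.TTheory GRing.Theory Num.Theory.
Import numFieldNormedType.Exports.

Local Open Scope classical_set_scope.
Local Open Scope ring_scope.

Definition mutually_independent (R : realType) (d d' : measure_display)
    (T : measurableType d) (T' : measurableType d') (P : probability T R)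
    (I : choiceType) (X : I -> {RV P >-> T'}) : Prop :=
  forall (J : {fset I}) (A : I -> set T'),
    (forall i, i \in J -> measurable (A i)) ->
    P (\bigcap_(i in [set` J]) (X i @^-1` A i)) =
    (\prod_(i <- J) P (X i @^-1` A i))%E.

(* A distribution function is singular when the Borel probability measure it
   determines is concentrated on a Lebesgue-null set; atoms are not excluded. *)
Definition singular_df (R : realType) (F : R -> R) : Prop :=
  exists mu : probability R R,
    (forall r : R, mu `]-oo, r]%classic = (F r)%:E) /\
    exists N : set R, [/\ measurable N,
      (@lebesgue_measure R) N = 0%E & mu (~` N) = 0%E].

Section digit_sum.
Context (R : realType) (d : measure_display) (T : measurableType d)
  (P : probability T R).
Variables (q : nat) (x : nat -> {RV P >-> nat}).

(* Digits are numbered from 0, so [x i] has weight q^-(i+1). *)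
Definition digit_sum (w : T) : R :=
  limn (series (fun i => (x i w)%:R / q%:R ^+ i.+1 : R)).

Lemma measurable_digit_sum : measurable_fun [set: T] digit_sum.
Proof.
pose u n w : R := series (fun i => (x i w)%:R / q%:R ^+ i.+1) n.
have und w : nondecreasing_seq (u ^~ w).
  apply/nondecreasing_series => n _ _.
  by rewrite mulr_ge0// invr_ge0 exprn_ge0.
have limE w : digit_sum w = fine (limn (EFin \o (u ^~ w))).
  have [cu|ncu] := pselect (cvgn (u ^~ w)); first by rewrite EFin_lim.
  have /cvgeryP uy : u n w @[n --> \oo] --> +oo%R.
    exact: nondecreasing_dvgn_lt.
  rewrite (cvg_lim _ uy)//= /digit_sum /lim /lim_in getPN// => l ul.
  by apply: ncu; apply/cvg_ex; exists l.
rewrite (_ : digit_sum = fine \o (fun w => limn (EFin \o (u ^~ w)))); last first.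
  by apply/funext => w /=; exact: limE.
have mlim : measurable_fun setT (fun w => limn (EFin \o (u ^~ w))); last first.
  exact: measurableT_comp.
apply: (emeasurable_fun_cvg (fun n w => (u n w)%:E) _) => [n|w _].
  apply/measurable_EFinP; apply: measurable_sum => i.
  apply: measurable_funM => //.
  by apply: (@measurableT_comp _ _ _ _ _ _ (fun k : nat => k%:R : R)).
by apply: ereal_nondecreasing_is_cvgn => m n mn; rewrite lee_fin und.
Qed.

HB.instance Definition _ :=
  isMeasurableFun.Build _ _ _ _ digit_sum measurable_digit_sum.

End digit_sum.

(* Main.v *)
Require Import Defs.
From HB Require Import structures.
From mathcomp Require Import all_boot all_order all_algebra finmap.
From mathcomp Require Import all_classical all_reals all_analysis.
From mathcomp Require Import measurable_realfun ring lra.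

Import Order.TTheory GRing.Theory Num.Theory.
Import numFieldNormedType.Exports.

Local Open Scope classical_set_scope.
Local Open Scope ring_scope.

(** The digits enter only through the laws of the finite words that they spell.
    By independence, the word (x_0, ..., x_(n-1)) equals f with probability
    weight p f, the product of the p (f i) ([prob_digit_word]), so the law of
    the n-th partial sum X_n is an explicit finite sum over words. As the X_n
    increase to X, the event X <= r is the decreasing intersection of the events
    X_n <= r, and F r is the limit of P[X_n <= r] ([word_cdf_cvg]).

    Recursion. Splitting a word into its first digit and the rest gives
    P[X_(n+1) <= r] = sum_j p_j P[X_n <= q r - j], and in the limit
    F r = sum_j p_j F (q r - j) for every real r ([df_fixpoint]). As X lies in
    [0, 1], F vanishes on the negative reals and is 1 from 1 on; for r in
    [k/q, (k+1)/q] the terms with j < k are thus p_j, and those with j > k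
    vanish, the value F 0 = 0 resulting from F 0 = p_0 F 0 and p_0 <> 1.

    Uniform die. By the recursion, the distance between F and the identity on
    [0, 1] is divided by q at each step, so it is at most q^-n for every n.

    Biased die. Let rho be the sum of the sqrt (p_j / q), that is, the Hellinger
    affinity of the law of a digit and the uniform law. It is < 1 as soon as the
    two laws differ ([affinity_lt1]), and on words of length n it tensorizes to
    rho^n. Call a word of length n heavy when its weight is at least q^-n. The
    smaller of q^-n and the weight is at most their geometric mean, so the q-adic intervals of the heavy words have total length at most rho^n
    ([heavy_words]), while X misses all of them with probability at most rho^n
    ([light_words]). The limit superior N of these unions of intervals is
    Lebesgue-null by Borel-Cantelli, and X is in N almost surely. *)

(** * Finite words of digits *)
Section words.
Context (R : realType) (q : nat).
Implicit Types (p : 'I_q -> R) (n : nat).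

Definition weight p {n} (f : {ffun 'I_n -> 'I_q}) : R := \prod_i p (f i).

Definition word_value {n} (f : {ffun 'I_n -> 'I_q}) : R :=
  \sum_(i < n) (f i)%:R / q%:R ^+ i.+1.

Definition cons_word {n} (jf : 'I_q * {ffun 'I_n -> 'I_q}) :
    {ffun 'I_n.+1 -> 'I_q} :=
  [ffun i => oapp jf.2 jf.1 (unlift ord0 i)].

Lemma cons_word0 n (jf : 'I_q * {ffun 'I_n -> 'I_q}) : cons_word jf ord0 = jf.1.
Proof. by rewrite ffunE unlift_none. Qed.

Lemma cons_wordS n (jf : 'I_q * {ffun 'I_n -> 'I_q}) (i : 'I_n) :
  cons_word jf (lift ord0 i) = jf.2 i.
Proof. by rewrite ffunE liftK. Qed.

Lemma cons_word_bij n : bijective (@cons_word n).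
Proof.
exists (fun g : {ffun 'I_n.+1 -> 'I_q} =>
  (g ord0, [ffun i => g (lift ord0 i)])) => [[j f]|g].
  by rewrite cons_word0; congr pair; apply/ffunP => i; rewrite ffunE cons_wordS.
by apply/ffunP => i; rewrite ffunE; case: unliftP => [k ->|->] //=; rewrite ffunE.
Qed.

Lemma weight_cons p n (jf : 'I_q * {ffun 'I_n -> 'I_q}) :
  weight p (cons_word jf) = p jf.1 * weight p jf.2.
Proof.
rewrite /weight big_ord_recl cons_word0; congr (_ * _).
by apply: eq_bigr => i _; rewrite cons_wordS.
Qed.

Lemma word_value_cons n (jf : 'I_q * {ffun 'I_n -> 'I_q}) : (0 < q)%N ->
  word_value (cons_word jf) = (jf.1%:R + word_value jf.2) / q%:R.
Proof.
move=> q0; rewrite /word_value big_ord_recl cons_word0 expr1 mulrDl; congr (_ + _).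
rewrite mulr_suml; apply: eq_bigr => i _; rewrite cons_wordS/=.
by rewrite -mulrA -invfM -exprSr.
Qed.

Lemma weight_ge0 p n (f : {ffun 'I_n -> 'I_q}) : (forall j, 0 <= p j) ->
  0 <= weight p f.
Proof. by move=> p0; rewrite prodr_ge0. Qed.

Lemma sum_weight p n :
  \sum_(f : {ffun 'I_n -> 'I_q}) weight p f = (\sum_j p j) ^+ n.
Proof.
rewrite -[in RHS](card_ord n) -prodr_const bigA_distr_bigA.
by apply: eq_bigr => f _; exact: eq_bigl.
Qed.

Definition word_cdf p n (r : R) : R :=
  \sum_(f : {ffun 'I_n -> 'I_q} | word_value f <= r) weight p f.

(** The recursion of the theorem at a finite stage: conditioning on the first
    digit, which carries the weight 1/q while the rest is scaled by 1/q. *)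
Lemma word_cdfS p n r : (0 < q)%N ->
  word_cdf p n.+1 r = \sum_(j < q) p j * word_cdf p n (q%:R * r - j%:R).
Proof.
move=> q0; rewrite /word_cdf (reindex _ (onW_bij _ (cons_word_bij n)))/=.
under eq_bigl => jf.
  rewrite word_value_cons// ler_pdivrMr ?ltr0n// mulrC -lerBrDl; over.
under eq_bigr do rewrite weight_cons.
under [RHS]eq_bigr do rewrite mulr_sumr.
by rewrite [RHS](pair_big_dep xpredT
  (fun (j : 'I_q) (f : {ffun 'I_n -> 'I_q}) => word_value f <= q%:R * r - j%:R)
  (fun j f => p j * weight p f))/=; apply: eq_bigl => jf.
Qed.

(** * Heavy and light words *)

Section affinity.
Variable p : 'I_q -> R.
Hypothesis p_ge0 : forall j, 0 <= p j.
Hypothesis p_sum1 : \sum_(j < q) p j = 1.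

Let s j := Num.sqrt (p j / q%:R).

(** The Hellinger affinity (Bhattacharyya coefficient) of p and the uniform law
    on q letters. *)
Definition affinity : R := \sum_j s j.

Lemma affinity_ge0 : 0 <= affinity.
Proof. by apply: sumr_ge0 => j _; exact: sqrtr_ge0. Qed.

(** By the inequality between geometric and arithmetic means, the j-th term is
    at most the mean of p_j and 1/q, with a defect that is half the square of
    the difference of their square roots; the means sum to 1. *)
Lemma affinity_lt1 k : p k != q%:R^-1 -> affinity < 1.
Proof.
move=> pk; have q0 : (0 < q)%N by rewrite (leq_ltn_trans _ (ltn_ord k)).
have qn0 : q%:R != 0 :> R by rewrite pnatr_eq0 -lt0n.
have agm j : s j = (p j + q%:R^-1 - (Num.sqrt (p j) - Num.sqrt q%:R^-1) ^+ 2) / 2.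
  rewrite /s sqrtrM// sqrrB !sqr_sqrtr ?invr_ge0//.
  by field.
have -> : 1 = \sum_(j < q) (p j + q%:R^-1) / 2 :> R.
  rewrite -mulr_suml big_split/= p_sum1 sumr_const card_ord.
  by rewrite -[_^-1 *+ q]mulr_natl mulfV// divff// pnatr_eq0.
rewrite /affinity (bigD1 k)//= [X in _ < X](bigD1 k)//= ltr_leD//; last first.
  by apply: ler_sum => j _; rewrite agm ler_pM2r ?invr_gt0// gerBl sqr_ge0.
rewrite agm ltr_pM2r ?invr_gt0// gtrBl exprn_even_gt0//= subr_eq0.
by apply: contra pk => /eqP e; rewrite -(sqr_sqrtr (p_ge0 k)) e sqr_sqrtr.
Qed.

Lemma sqr_weight_affinity n (f : {ffun 'I_n -> 'I_q}) :
  weight s f ^+ 2 = weight p f * q%:R ^- n.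
Proof.
have -> : q%:R ^- n = \prod_(i < n) q%:R^-1 :> R.
  by rewrite prodr_const card_ord exprVn.
rewrite /weight -prodrXl -big_split/=.
by apply: eq_bigr => i _; rewrite sqr_sqrtr ?divr_ge0.
Qed.

(** The geometric mean of q^-n and the weight bounds the smaller of the two, here
    q^-n; summed over all words, these means give the n-th power of the affinity. *)
Lemma heavy_words n :
  \sum_(f : {ffun 'I_n -> 'I_q} | q%:R ^- n <= weight p f) q%:R ^- n
    <= affinity ^+ n.
Proof.
rewrite /affinity -sum_weight.
apply: (@le_trans _ _ (\sum_(f : {ffun 'I_n -> 'I_q} | q%:R ^- n <= weight p f)
   weight s f)).
  apply: ler_sum => f hf; rewrite -ler_sqr ?nnegrE ?invr_ge0 ?exprn_ge0 ?ler0n//.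
    by rewrite sqr_weight_affinity expr2 ler_wpM2r// invr_ge0 exprn_ge0.
  by apply: weight_ge0 => j; exact: sqrtr_ge0.
by rewrite [leRHS](bigID (fun f => q%:R ^- n <= weight p f))/= lerDl sumr_ge0// => f _;
  apply: weight_ge0 => j; exact: sqrtr_ge0.
Qed.

(** Counterpart of [heavy_words]: for the other words the weight is the smaller. *)
Lemma light_words n :
  \sum_(f : {ffun 'I_n -> 'I_q} | ~~ (q%:R ^- n <= weight p f)) weight p f
    <= affinity ^+ n.
Proof.
rewrite /affinity -sum_weight.
apply: (@le_trans _ _ (\sum_(f : {ffun 'I_n -> 'I_q} | ~~ (q%:R ^- n <= weight p f))
   weight s f)).
  apply: ler_sum => f; rewrite -ltNge => /ltW hf; rewrite -ler_sqr ?nnegrE ?weight_ge0//.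
    by rewrite sqr_weight_affinity expr2 ler_wpM2l// weight_ge0.
  by move=> j; exact: sqrtr_ge0.
by rewrite [leRHS](bigID (fun f => q%:R ^- n <= weight p f))/= lerDr sumr_ge0// => f _;
  apply: weight_ge0 => j; exact: sqrtr_ge0.
Qed.

End affinity.
End words.

Arguments weight {R q} p {n} f.
Arguments word_value R {q n} f.
Arguments word_cdf {R q} p n r.
Arguments affinity {R q} p.
Arguments affinity_ge0 {R q} p.

(** * Consequences of the self-similarity equation *)

Section functional_equation.
Context (R : realType) (q : nat) (p : 'I_q -> R) (F : R -> R).
Hypothesis hq : (2 <= q)%N.
Hypothesis p_sum1 : \sum_(j < q) p j = 1.
Hypothesis p_neq1 : forall j, p j != 1.
Hypothesis F_eq : forall r, F r = \sum_(j < q) p j * F (q%:R * r - j%:R).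
Hypothesis F_lt0 : forall r, r < 0 -> F r = 0.
Hypothesis F_ge1 : forall r, 1 <= r -> F r = 1.

(** At 0 the equation only sees the first digit 0, the other arguments being
    negative; so a mass at 0 would force p_0 = 1. *)
Lemma df_at0 : F 0 = 0.
Proof.
have q0 : (0 < q)%N by exact: ltnW.
pose o := Ordinal q0.
have : F 0 = p o * F 0.
  rewrite {1}F_eq (bigD1 o)//= mulr0 subr0 big1 ?addr0// => j jo.
  rewrite F_lt0 ?mulr0// sub0r oppr_lt0 ltr0n lt0n.
  by apply: contra jo => /eqP j0; apply/eqP/val_inj.
move/eqP; rewrite -subr_eq0 -{1}(mul1r (F 0)) -mulrBl mulf_eq0 subr_eq0.
by rewrite eq_sym (negbTE (p_neq1 o)) => /eqP.
Qed.

(** The digits below k contribute F = 1, and those above k an argument that is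
    at most 0. *)
Lemma df_recursion (k : 'I_q) r : k%:R / q%:R <= r <= k.+1%:R / q%:R ->
  F r = \sum_(j < q | (j < k)%N) p j + p k * F (q%:R * r - k%:R).
Proof.
have q0 : 0 < q%:R :> R by rewrite ltr0n ltnW.
rewrite ler_pdivrMr// ler_pdivlMr// mulrC => /andP[kr rk].
rewrite F_eq (bigID (fun j : 'I_q => (j < k)%N))/=; congr (_ + _).
  apply: eq_bigr => j jk; rewrite F_ge1 ?mulr1// lerBrDr (le_trans _ kr)//.
  by rewrite nat1r ler_nat.
rewrite (bigD1 k) ?ltnn//= big1 ?addr0// => j /andP[]; rewrite -leqNgt => kj jk.
have {jk}kj : (k < j)%N by rewrite ltn_neqAle kj andbT eq_sym.
have : q%:R * r - j%:R <= 0.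
  by rewrite subr_le0 (le_trans rk)// ler_nat.
by rewrite le_eqVlt => /predU1P[->|/F_lt0->]; rewrite ?df_at0 mulr0.
Qed.

(** Both F and the identity solve the recursion on [0, 1], whose right-hand side
    contracts distances by 1/q when all the p_j are 1/q. *)
Lemma df_uniform : (forall r, 0 <= F r <= 1) -> (forall j, p j = q%:R^-1) ->
  forall r, 0 <= r <= 1 -> F r = r.
Proof.
move=> F01 pE; have q0 : 0 < q%:R :> R by rewrite ltr0n ltnW.
have contr n : forall r, 0 <= r <= 1 -> `|F r - r| <= q%:R^-1 ^+ n.
  elim: n => [r /andP[r0 r1]|n IH r /andP[r0 r1]].
    rewrite expr0 ler_norml; have /andP[F0 F1] := F01 r.
    by apply/andP; split; lra.
  have [r1'|r1'] := leP 1 r.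
    have -> : r = 1 by apply/eqP; rewrite eq_le r1.
    by rewrite F_ge1// subrr normr0 exprn_ge0// invr_ge0 ltW.
  pose m := Num.truncn (q%:R * r).
  have /andP[m1 m2] : m%:R <= q%:R * r < m.+1%:R.
    by apply: truncn_itv; rewrite mulr_ge0// ltW.
  have mq : (m < q)%N.
    by rewrite -(ltr_nat R) (le_lt_trans m1)// gtr_pMr.
  have := df_recursion (Ordinal mq) r.
  rewrite ler_pdivrMr// ler_pdivlMr//= mulrC m1 ltW// => /(_ isT) ->.
  have -> : \sum_(j < q | (j < m)%N) p j = m%:R / q%:R.
    under eq_bigr do rewrite pE.
    by rewrite -(big_ord_widen _ (fun=> q%:R^-1) (ltnW mq)) sumr_const card_ord mulr_natl.
  rewrite pE.
  have -> : m%:R / q%:R + q%:R^-1 * F (q%:R * r - m%:R) - r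
     = q%:R^-1 * (F (q%:R * r - m%:R) - (q%:R * r - m%:R)).
    by field; rewrite gt_eqF.
  rewrite normrM exprS ger0_norm ?invr_ge0 ?(ltW q0)// ler_pM2l ?invr_gt0//.
  apply: IH; rewrite subr_ge0 m1/= lerBlDr nat1r; exact: ltW.
move=> r r01; apply/eqP; rewrite -subr_eq0 -normr_le0.
have : q%:R^-1 ^+ n @[n --> \oo] --> (0 : R).
  rewrite exprn_geometric; apply: cvg_geometric.
  by rewrite ger0_norm ?invr_ge0 ?(ltW q0)// invf_lt1// ltr1n.
move=> /cvgr_to_ge; apply; apply: nearW => n; exact: contr.
Qed.

End functional_equation.

(** * Expansions in base q *)

Section expansion.
Context (R : realType) (q : nat) (a : nat -> nat).
Hypothesis hq : (2 <= q)%N.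
Hypothesis a_lt : forall i, (a i < q)%N.

Let u : nat -> R := series (fun i => (a i)%:R / q%:R ^+ i.+1).

Lemma expansion_nondecreasing : nondecreasing_seq u.
Proof.
apply/nondecreasing_series => i _ _.
by rewrite divr_ge0 ?exprn_ge0.
Qed.

(** The partial sums are the left ends of nested q-adic intervals, of length q^-n,
    and this is the monotonicity of the right ends; it bounds the partial sums,
    hence gives convergence, and locates the limit within each interval. *)
Lemma expansion_upper_nonincreasing :
  nonincreasing_seq (fun n => u n + q%:R ^- n).
Proof.
have q0 : 0 < q%:R :> R by rewrite ltr0n ltnW.
apply/nonincreasing_seqP => n; rewrite /u /series/= big_nat_recr//= -addrA lerD2l.
rewrite -[X in _ + X]mul1r -mulrDl ler_pdivrMr ?exprn_gt0// exprSr mulrA.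
by rewrite mulVf ?expf_neq0 ?gt_eqF// mul1r natr1 ler_nat.
Qed.

Lemma expansion_le m n : u m <= u n + q%:R ^- n.
Proof.
have [mn|/ltnW nm] := leqP m n.
  by rewrite (le_trans (expansion_nondecreasing _ _ mn))// lerDl invr_ge0 exprn_ge0.
apply: le_trans (expansion_upper_nonincreasing _ _ nm).
by rewrite lerDl invr_ge0 exprn_ge0.
Qed.

Lemma is_cvg_expansion : cvgn u.
Proof.
apply: nondecreasing_is_cvgn; first exact: expansion_nondecreasing.
by exists (u 0 + q%:R ^- 0) => _ [m _ <-]; exact: expansion_le.
Qed.

Lemma expansion_itv n : u n <= limn u <= u n + q%:R ^- n.
Proof.
apply/andP; split.
  exact: (nondecreasing_cvgn_le expansion_nondecreasing is_cvg_expansion).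
apply: limr_le; first exact: is_cvg_expansion.
by apply: nearW => m; exact: expansion_le.
Qed.

Lemma expansion_lim_leP r : limn u <= r <-> forall n, u n <= r.
Proof.
split=> [ur n|ur].
  by apply: le_trans ur; have /andP[] := expansion_itv n.
by apply: limr_le; [exact: is_cvg_expansion|exact: nearW].
Qed.

End expansion.

(** * The law of the random digits *)

Section die.
Context (R : realType) (d : measure_display) (T : measurableType d)
  (P : probability T R) (q : nat) (p : 'I_q -> R) (x : nat -> {RV P >-> nat}).
Hypothesis hq : (2 <= q)%N.
Hypothesis p_ge0 : forall j, 0 <= p j.
Hypothesis p_sum1 : \sum_(j < q) p j = 1.
Hypothesis x_lt : forall i w, (x i w < q)%N.
Hypothesis x_indep : mutually_independent x.
Hypothesis x_law :
  forall i (j : 'I_q), P (x i @^-1` [set nat_of_ord j]) = (p j)%:E.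

Definition digit_word n w : {ffun 'I_n -> 'I_q} :=
  [ffun i : 'I_n => Ordinal (x_lt i w)].

(** Puts the event that the first n digits spell f in the form to which mutual
    independence applies: a family of events indexed by all naturals, trivial
    from n on. *)
Lemma digit_word_bigcap n (f : {ffun 'I_n -> 'I_q})
    (A := fun i : nat =>
      if insub i is Some k then [set nat_of_ord (f k)] else setT) :
  digit_word n @^-1` [set f] =
  \bigcap_(i in [set` [fset i in iota 0 n]%fset]) (x i @^-1` A i).
Proof.
apply/seteqP; split=> w /=.
  move=> wf i; rewrite /= !inE mem_iota/= add0n => ni.
  by rewrite /A insubT /= -wf ffunE.
move=> h; apply/ffunP => k; apply/val_inj; rewrite ffunE/=.
have := h k; rewrite /= inE mem_iota/= add0n ltn_ord => /(_ isT).
by rewrite /A valK.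
Qed.

Lemma measurable_digit_word n (f : {ffun 'I_n -> 'I_q}) :
  measurable (digit_word n @^-1` [set f]).
Proof.
rewrite digit_word_bigcap; apply: fin_bigcap_measurable; first exact: finite_fset.
by move=> i _; exact: measurable_funPTI.
Qed.

Lemma prob_digit_word n (f : {ffun 'I_n -> 'I_q}) :
  P (digit_word n @^-1` [set f]) = (weight p f)%:E.
Proof.
rewrite digit_word_bigcap x_indep//.
have pm : perm_eq [fset i in iota 0 n]%fset (index_iota 0 n).
  apply: uniq_perm; rewrite ?fset_uniq ?iota_uniq// => i.
  by rewrite !inE /index_iota subn0.
rewrite (perm_big _ pm)/= big_mkord /weight -prodEFin.
by apply: eq_bigr => i _; rewrite valK x_law.
Qed.

Lemma digit_event_bigcup n (Q : pred {ffun 'I_n -> 'I_q}) :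
  [set w | Q (digit_word n w)] =
  \bigcup_(f in [set` Q]) (digit_word n @^-1` [set f]).
Proof.
apply/seteqP; split=> [w Qw|w [f Qf /= wf]]; first by exists (digit_word n w).
by rewrite wf.
Qed.

Lemma measurable_digit_event n (Q : pred {ffun 'I_n -> 'I_q}) :
  measurable [set w | Q (digit_word n w)].
Proof.
rewrite digit_event_bigcup; apply: fin_bigcup_measurable; first exact: finite_finset.
by move=> f _; exact: measurable_digit_word.
Qed.

Lemma prob_digit_event n (Q : pred {ffun 'I_n -> 'I_q}) :
  P [set w | Q (digit_word n w)] = (\sum_(f | Q f) weight p f)%:E.
Proof.
rewrite digit_event_bigcup measure_fin_bigcup; last first.
- by move=> f _; exact: measurable_digit_word.
- by move=> f g _ _ [w []] /= <- <-.
- exact: finite_finset.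
rewrite -(@bigfs _ _ _ _ (index_enum {ffun 'I_n -> 'I_q})) ?index_enum_uniq//; last first.
  by move=> f _; rewrite mem_index_enum.
by rewrite -sumEFin; apply: eq_bigr => f _; exact: prob_digit_word.
Qed.

Lemma word_value_digit n w : word_value R (digit_word n w) =
  series (fun i => (x i w)%:R / q%:R ^+ i.+1 : R) n.
Proof.
by rewrite /word_value /series/= big_mkord; apply: eq_bigr => i _; rewrite ffunE.
Qed.

Lemma digit_sum_itv n w :
  word_value R (digit_word n w) <= digit_sum q x w
    <= word_value R (digit_word n w) + q%:R ^- n.
Proof. by rewrite word_value_digit; apply: expansion_itv. Qed.

Let X : {RV P >-> R} := digit_sum q x.
Let F (r : R) : R := fine (cdf X r).

(** Continuity of P from above: a partial sum never exceeds X, so X <= r means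
    that all the partial sums are at most r. *)
Lemma word_cdf_cvg r : word_cdf p n r @[n --> \oo] --> F r.
Proof.
pose E n := [set w | word_value R (digit_word n w) <= r].
have mE n : measurable (E n).
  exact: (measurable_digit_event n (fun f => word_value R f <= r)).
have PE n : P (E n) = (word_cdf p n r)%:E.
  exact: (prob_digit_event n (fun f => word_value R f <= r)).
have XE : X @^-1` `]-oo, r] = \bigcap_n E n.
  apply/seteqP; split=> w /=; rewrite in_itv/=.
    move=> Xr n _; rewrite /E/= word_value_digit.
    by move: n; apply/(expansion_lim_leP R q (x ^~ w) hq).
  move=> h; apply/(expansion_lim_leP R q (x ^~ w) hq) => // n.
  by rewrite -word_value_digit; exact: h.
have : (P \o E) n @[n --> \oo] --> P (\bigcap_n E n).
  apply: nonincreasing_cvg_mu => //.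
  - by apply: (le_lt_trans (probability_le1 _ _)); rewrite ?ltry.
  - exact: bigcapT_measurable.
  - move=> m n mn; apply/subsetPset => w; rewrite /E/= !word_value_digit.
    apply: le_trans; exact: expansion_nondecreasing.
rewrite -XE => PX.
rewrite (_ : (fun n => _) = fine \o (P \o E)); last first.
  by apply/funext => n /=; rewrite PE.
apply: fine_cvg; rewrite fineK//.
by rewrite fin_num_measure.
Qed.

(** The limit of [word_cdfS]; it replaces the usual argument that the shifted
    series has the law of X and is independent of the first digit. *)
Lemma df_fixpoint r : F r = \sum_(j < q) p j * F (q%:R * r - j%:R).
Proof.
have h : word_cdf p n.+1 r @[n --> \oo] --> F r.
  by have := word_cdf_cvg r; rewrite -cvg_shiftS.
have h' : word_cdf p n.+1 r @[n --> \oo] -->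
    \sum_(j < q) p j * F (q%:R * r - j%:R).
  under eq_cvg do rewrite (word_cdfS _ _ _ _ _ (ltnW hq)).
  apply: cvg_big => [|j _]; first exact: add_continuous.
  by apply: cvgMl_tmp; exact: word_cdf_cvg.
exact: (cvg_unique _ h h').
Qed.

Lemma df_ge0_le1 r : 0 <= F r <= 1.
Proof.
have fr : cdf X r \is a fin_num by rewrite fin_num_measure.
by rewrite -!lee_fin fineK// cdf_ge0 cdf_le1.
Qed.

Lemma digit_sum_ge0_le1 w : 0 <= digit_sum q x w <= 1.
Proof.
by have := digit_sum_itv 0 w; rewrite /word_value big_ord0 add0r expr0 invr1.
Qed.

Lemma df_lt0 r : r < 0 -> F r = 0.
Proof.
move=> r0; rewrite /F /cdf /distribution /pushforward.
rewrite (_ : _ @^-1` _ = set0) ?measure0//; apply/seteqP; split=> w //=.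
rewrite in_itv/= leNgt (lt_le_trans r0)//.
by have /andP[] := digit_sum_ge0_le1 w.
Qed.

Lemma df_ge1 r : 1 <= r -> F r = 1.
Proof.
move=> r1; rewrite /F /cdf /distribution /pushforward.
rewrite (_ : _ @^-1` _ = setT) ?probability_setT//; apply/seteqP; split=> w //= _.
rewrite in_itv/= (le_trans _ r1)//.
by have /andP[] := digit_sum_ge0_le1 w.
Qed.

(** * Singularity *)

Definition heavy_set n : set R :=
  \big[setU/set0]_(f : {ffun 'I_n -> 'I_q} | q%:R ^- n <= weight p f)
    `[word_value R f, word_value R f + q%:R ^- n]%classic.

Lemma measurable_heavy_set n : measurable (heavy_set n).
Proof. by apply: bigsetU_measurable => f _; exact: measurable_itv. Qed.

Lemma lebesgue_heavy_set n :
  (lebesgue_measure (heavy_set n) <= (affinity p ^+ n)%:E)%E.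
Proof.
apply: (@le_trans _ _ (\sum_(f : {ffun 'I_n -> 'I_q}
    | q%:R ^- n <= weight p f) (q%:R ^- n : R))%:E); last first.
  by rewrite lee_fin heavy_words.
suff : measurable (heavy_set n) /\ (lebesgue_measure (heavy_set n) <=
  (\sum_(f : {ffun 'I_n -> 'I_q} | q%:R ^- n <= weight p f)
    (q%:R ^- n : R))%:E)%E by case.
rewrite /heavy_set; elim/big_ind2 : _ => [|A a B b [mA Aa] [mB Bb]|f _].
- by rewrite measure0.
- split; first exact: measurableU.
  by apply: (le_trans (measureU2 (@lebesgue_measure R) mA mB)); rewrite EFinD leeD.
- split; first exact: measurable_itv.
  rewrite lebesgue_measure_itv/= lte_fin ltrDl invr_gt0 exprn_gt0 ?ltr0n ?(ltnW hq)//.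
  by rewrite -EFinD lee_fin addrAC subrr add0r.
Qed.

(** X always lies in the q-adic interval of its first n digits, so it can avoid
    the heavy intervals only when these digits form a light word. *)
Lemma prob_not_heavy_set n :
  (distribution P X (~` heavy_set n) <= (affinity p ^+ n)%:E)%E.
Proof.
apply: (@le_trans _ _ (\sum_(f : {ffun 'I_n -> 'I_q}
    | ~~ (q%:R ^- n <= weight p f)) weight p f)%:E); last first.
  by rewrite lee_fin light_words.
rewrite -(prob_digit_event n (fun f => ~~ (q%:R ^- n <= weight p f))).
rewrite /distribution /pushforward; apply: le_measure; rewrite ?inE.
- apply: measurable_funPTI => //; apply: measurableC; exact: measurable_heavy_set.
- exact: (measurable_digit_event n (fun f => ~~ (q%:R ^- n <= weight p f))).
- move=> w /= Xw; apply/negP => hw; apply: Xw.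
  rewrite /heavy_set (bigD1 (digit_word n w))//=; left.
  by rewrite /= in_itv/=; exact: digit_sum_itv.
Qed.

(** The two geometric bounds are used differently: summability gives Borel-Cantelli
    for Lebesgue measure, while for the law of X the bound need only tend to 0,
    as missing all heavy sets from m on implies missing the n-th for large n. *)
Lemma df_singular k : p k != q%:R^-1 -> singular_df F.
Proof.
move=> pk; exists (distribution P X); split.
  by move=> r; rewrite /F fineK// fin_num_measure.
have rho0 := affinity_ge0 p.
have rho1 : affinity p < 1 by exact: affinity_lt1 pk.
have mH := measurable_heavy_set.
have rhoN : `|affinity p| < 1 by rewrite ger0_norm.
exists (lim_sup_set heavy_set); split.
- apply: bigcapT_measurable => n; apply: bigcup_measurable => j _; exact: mH.
- apply: lim_sup_set_cvg0 => //.
  apply: (@le_lt_trans _ _ (\sum_(n <oo) (affinity p ^+ n)%:E)%E).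
    by apply: lee_nneseries => // n _; exact: lebesgue_heavy_set.
  rewrite [ltLHS](_ : _ = limn (EFin \o series (geometric 1 (affinity p)))).
    by rewrite EFin_lim ?ltry//; exact: is_cvg_geometric_series.
  apply/congr_lim/funext => n /=; rewrite /series/= -sumEFin.
  by apply: eq_bigr => i _; rewrite mul1r.
- have B0 m : distribution P X (~` (\bigcup_(j >= m) heavy_set j)) = 0%E.
    apply/eqP; rewrite -measure_le0.
    have : (affinity p ^+ n)%:E @[n --> \oo] --> 0%:E.
      apply: cvg_EFin; first exact: nearW.
      by rewrite exprn_geometric; exact: cvg_geometric.
    move=> /cvge_to_ge; apply.
    exists m => // j /= mj.
    apply: le_trans (prob_not_heavy_set j); apply: le_measure; rewrite ?inE.
    + by apply: measurableC; apply: bigcup_measurable.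
    + exact: measurableC.
    + by apply: subsetC => y hy; exists j.
  rewrite /lim_sup_set setC_bigcap; apply/negligibleP.
    apply: bigcupT_measurable => m; apply: measurableC.
    exact: bigcup_measurable.
  apply: negligible_bigcup => m; apply/negligibleP; last exact: B0.
  by apply: measurableC; exact: bigcup_measurable.
Qed.

End die.

(** * The distribution function of the digit sum *)

Theorem theorem3p2 (R : realType) (d : measure_display) (T : measurableType d)
    (P : probability T R) (q : nat) (p : 'I_q -> R) (x : nat -> {RV P >-> nat})
    (hq : (2 <= q)%N)
    (p_ge0 : forall j, 0 <= p j)
    (p_sum1 : \sum_(j < q) p j = 1)
    (p_neq1 : forall j, p j != 1)
    (x_lt : forall i w, (x i w < q)%N)
    (x_indep : mutually_independent x)
    (x_law : forall i (j : 'I_q), P (x i @^-1` [set nat_of_ord j]) = (p j)%:E) :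
  let X : {RV P >-> R} := digit_sum q x in
  let F (r : R) : R := fine (cdf X r) in
  [/\ (forall j, p j = q%:R^-1) -> forall r, 0 <= r <= 1 -> F r = r,
      (exists k, p k != q%:R^-1) -> singular_df F
    & forall (k : 'I_q) (r : R), k%:R / q%:R <= r <= k.+1%:R / q%:R ->
        F r = \sum_(j < q | (j < k)%N) p j + p k * F (q%:R * r - k%:R)].
Proof.
move=> X F.
have F_eq := df_fixpoint R d T P q p x hq x_lt x_indep x_law.
have F_lt0 := df_lt0 R d T P q x hq x_lt.
have F_ge1 := df_ge1 R d T P q x hq x_lt.
split=> [pE|[k pk]|k r kr].
- by apply: (df_uniform R q p F) => // r; exact: df_ge0_le1.
- exact: (df_singular R d T P q p x hq p_ge0 p_sum1 x_lt x_indep x_law k pk).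
- exact: (df_recursion R q p F).
Qed.
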